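(* Work in homotopy type theory with univalence and function extensionality. For any types $A, B$ and any function $f : A \to B$, the type \[ \mathsf{ish2adj}\, f :\equiv \sum_{g : B \to A} \ \sum_{\eta : gf \sim \mathsf{id}_A} \ \sum_{\varepsilon : fg \sim \mathsf{id}_B} \ \sum_{\tau : f[\eta] \sim \varepsilon_{f}} \ \sum_{\theta : \eta_{g} \sim g[\varepsilon]} \ \big(\mathsf{Coh}\, \eta \cdot g \llbracket \tau \rrbracket \sim \theta_f\big) \] is a proposition (any two of its elements are equal).
   Context: Notation: for $h : X \to Y$ and a path $p : x = y$, $h[p] : hx = hy$ denotes $\mathsf{ap}_h(p)$; for 2-paths $\alpha : p = q$, $h\llbracket \alpha \rrbracket : h[p] = h[q]$ denotes the action of $h$ on 2-paths. A homotopy $H : f \sim g$ is an element of $\prod_x f x = g x$. For $H : f \sim g$ with $f,g : A \to B$: for $k : C \to A$, $H_k : fk \sim gk$ is $\lambda c.\, H_{k c}$; for $h : B \to C$, $h[H] : hf \sim hg$ is $\lambda x.\, h[H_x]$; for $\alpha : H \sim H'$ (i.e. $\prod_x H_x = H'_x$), $h\llbracket \alpha \rrbracket : h[H] \sim h[H']$ is $\lambda x.\, h\llbracket \alpha_x \rrbracket$. Concatenation $H \cdot H'$ of homotopies (and of homotopies between homotopies) is pointwise path concatenation in diagrammatic order. For $f : A \to B$, $g : B \to A$ and $H : gf \sim \mathsf{id}_A$, the homotopy $\mathsf{Coh}\, H : H_{gf} \sim g[f[H]]$ is defined pointwise: $(\mathsf{Coh}\, H)_x : H_{g(f x)} = g[f[H_x]]$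 is the concatenation of the path $H_{g(fx)} = (gf)[H_x]$ given by naturality of $H$ (applied to the path $H_x$, cancelling $H_x$) with the functoriality path $(gf)[H_x] = g[f[H_x]]$. *)

(* Defs.v *)
(* Rocq's [eq] lives in Prop (and proof irrelevance is whitelisted), so we
   use a Type-valued identity type [paths] as in the HoTT library. *)

Inductive paths {A : Type} (a : A) : A -> Type :=
  idpath : paths a a.
Arguments idpath {A a}.

Definition concat {A : Type} {x y z : A} (p : paths x y) (q : paths y z)
  : paths x z :=
  match q in paths _ z return paths x z with idpath => p end.

Definition inverse {A : Type} {x y : A} (p : paths x y) : paths y x :=
  match p in paths _ y return paths y x with idpath => idpath end.

(* h[p] = ap_h(p) *)
Definition ap {A B : Type} (h : A -> B) {x y : A} (p : paths x y)
  : paths (h x) (h y) :=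
  match p in paths _ y return paths (h x) (h y) with idpath => idpath end.

Definition homotopy {A : Type} {P : A -> Type} (f g : forall x, P x) : Type :=
  forall x, paths (f x) (g x).

Definition happly {A : Type} {P : A -> Type} {f g : forall x, P x}
  (p : paths f g) : homotopy f g :=
  fun x => match p in paths _ g return paths (f x) (g x) with idpath => idpath end.

Definition IsEquiv {X Y : Type} (e : X -> Y) : Type :=
  prod { s : Y -> X & forall y, paths (e (s y)) y }
       { r : Y -> X & forall x, paths (r (e x)) x }.

Definition Funext : Type :=
  forall (A : Type) (P : A -> Type) (f g : forall x, P x),
    IsEquiv (@happly A P f g).

Definition IsHProp (X : Type) : Type := forall u v : X, paths u v.

Definition nat_to_id {A : Type} {h : A -> A} (H : forall x, paths (h x) x)
  {x y : A} (p : paths x y) : paths (concat (H x) p) (concat (ap h p) (H y)).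
Proof. destruct p. destruct (H x). reflexivity. Defined.

Definition cancelR {A : Type} {x y z : A} (a b : paths x y) (q : paths y z)
  (e : paths (concat a q) (concat b q)) : paths a b.
Proof. destruct q. exact e. Defined.

Definition ap_compose {A B C : Type} (f : A -> B) (g : B -> C) {x y : A}
  (p : paths x y) : paths (ap (fun a => g (f a)) p) (ap g (ap f p)).
Proof. destruct p. reflexivity. Defined.

(* Coh H : H_{gf} ~ g[f[H]],
   (Coh H)_x := (H_{g(fx)} = (gf)[H_x] by naturality, cancelling H_x)
                . ((gf)[H_x] = g[f[H_x]]) *)
Definition Coh {A B : Type} {f : A -> B} {g : B -> A}
  (H : forall x, paths (g (f x)) x) :
  forall x, paths (H (g (f x))) (ap g (ap f (H x))) :=
  fun x => concat
    (cancelR (H (g (f x))) (ap (fun a => g (f a)) (H x)) (H x)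
       (nat_to_id (h := fun a => g (f a)) H (H x)))
    (ap_compose f g (H x)).

Definition ish2adj {A B : Type} (f : A -> B) : Type :=
  { g : B -> A &
  { eta : forall a, paths (g (f a)) a &
  { eps : forall b, paths (f (g b)) b &
  { tau : forall a, paths (ap f (eta a)) (eps (f a)) &
  { theta : forall b, paths (eta (g b)) (ap g (eps b)) &
    forall a, paths (concat (Coh eta a) (ap (ap g) (tau a))) (theta (f a))
  } } } } }.

(* Main.v *)
Require Import Defs.

(* An element (g, eta, eps, tau, theta, _) of ish2adj f contains the
   half-adjoint equivalence (g, eta, eps, tau), so if ish2adj f is inhabited
   the fibres of f are contractible, and it suffices to show that ish2adj f is
   then contractible.  Regroup it as (g, eps), (eta, tau), (theta, _).  The
   pairs (g, eps) are the elements of Pi_b fib b; for fixed (g, eps), the pair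
   (eta_a, tau_a) is a path in fib (f a) from (g (f a), eps (f a)) to (a, 1);
   and (theta, _) is an extension along f of a family over A, which is unique
   because f has contractible fibres.  Each layer is contractible. *)

Definition IsContr (X : Type) : Type := {c : X & forall x, paths c x}.

Definition concat_1p {X : Type} {x y : X} (p : paths x y) :
  paths (concat idpath p) p.
Proof. destruct p. reflexivity. Defined.

Definition concat_Vp {X : Type} {x y : X} (p : paths x y) :
  paths (concat (inverse p) p) idpath.
Proof. destruct p. reflexivity. Defined.

Definition transport {X : Type} (P : X -> Type) {x y : X} (p : paths x y)
  (u : P x) : P y :=
  match p with idpath => u end.

Definition path_forall (fe : Funext) {X : Type} {P : X -> Type}
  {h k : forall x, P x} (H : homotopy h k) : paths h k :=
  projT1 (fst (fe X P h k)) H.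

Lemma hprop_inhabited_contr (X : Type) : (X -> IsContr X) -> IsHProp X.
Proof.
  intros H u v. destruct (H u) as [c C].
  exact (concat (inverse (C u)) (C v)).
Qed.

Lemma contr_retract {X Y : Type} (r : Y -> X) (s : X -> Y)
  (rs : forall x, paths (r (s x)) x) : IsContr Y -> IsContr X.
Proof.
  intros [c C]. exists (r c). intro x.
  exact (concat (ap r (C (s x))) (rs x)).
Qed.

Lemma contr_paths_contr {X : Type} : IsContr X -> forall x y : X, IsContr (paths x y).
Proof.
  intros [c C] x y. exists (concat (inverse (C x)) (C y)).
  intro e. destruct e. apply concat_Vp.
Qed.

Lemma contr_basedpaths {X : Type} (x : X) : IsContr {y : X & paths x y}.
Proof.
  exists (existT _ x idpath). intros [y p]. destruct p. reflexivity.
Qed.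

Lemma contr_sigma {X : Type} (Y : X -> Type) :
  IsContr X -> (forall x, IsContr (Y x)) -> IsContr {x : X & Y x}.
Proof.
  intros [x0 C] HY. exists (existT _ x0 (projT1 (HY x0))). intros [x y].
  destruct (C x). exact (ap (existT Y x0) (projT2 (HY x0) y)).
Qed.

Lemma contr_sigma_curried {X : Type} {Y : X -> Type}
  (Z : forall x, Y x -> Type) :
  IsContr {x : X & Y x} -> (forall x y, IsContr (Z x y)) ->
  IsContr {x : X & {y : Y x & Z x y}}.
Proof.
  intros HXY HZ.
  apply (contr_retract
    (fun w : {xy : {x : X & Y x} & Z (projT1 xy) (projT2 xy)} =>
       existT _ (projT1 (projT1 w)) (existT _ (projT2 (projT1 w)) (projT2 w)))
    (fun w : {x : X & {y : Y x & Z x y}} =>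
       existT (fun xy => Z (projT1 xy) (projT2 xy))
         (existT _ (projT1 w) (projT1 (projT2 w))) (projT2 (projT2 w)))).
  - intros [x [y z]]. reflexivity.
  - apply contr_sigma; [exact HXY | intros [x y]; apply HZ].
Qed.

Lemma contr_sigma_swap {X : Type} {Y Z : X -> Type}
  (W : forall x, Y x -> Z x -> Type) :
  IsContr {x : X & {z : Z x & {y : Y x & W x y z}}} ->
  IsContr {x : X & {y : Y x & {z : Z x & W x y z}}}.
Proof.
  apply contr_retract
    with (fun w : {x : X & {z : Z x & {y : Y x & W x y z}}} =>
            existT (fun x => {y : Y x & {z : Z x & W x y z}}) (projT1 w)
              (existT _ (projT1 (projT2 (projT2 w)))
                 (existT _ (projT1 (projT2 w)) (projT2 (projT2 (projT2 w))))))
         (fun w : {x : X & {y : Y x & {z : Z x & W x y z}}} =>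
            existT (fun x => {z : Z x & {y : Y x & W x y z}}) (projT1 w)
              (existT _ (projT1 (projT2 (projT2 w)))
                 (existT _ (projT1 (projT2 w)) (projT2 (projT2 (projT2 w)))))).
  intros [x [y [z v]]]. reflexivity.
Qed.

Lemma contr_forall (fe : Funext) {X : Type} (P : X -> Type) :
  (forall x, IsContr (P x)) -> IsContr (forall x, P x).
Proof.
  intros H. exists (fun x => projT1 (H x)). intro k.
  apply (path_forall fe). intro x. exact (projT2 (H x) (k x)).
Qed.

Lemma contr_cocone_contr (fe : Funext) {U X : Type} (Q : U -> X) :
  IsContr U -> IsContr {t : X & forall u, paths (Q u) t}.
Proof.
  intros [u0 C].
  apply (contr_retract
    (fun w : {t : X & paths (Q u0) t} =>
       existT (fun t => forall u, paths (Q u) t) (projT1 w)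
         (fun u => concat (ap Q (inverse (C u))) (projT2 w)))
    (fun w : {t : X & forall u, paths (Q u) t} =>
       existT (fun t => paths (Q u0) t) (projT1 w) (projT2 w u0))).
  - intros [t k]. apply (ap (existT _ t)), (path_forall fe). intro u.
    simpl. destruct (C u). apply concat_1p.
  - apply contr_basedpaths.
Qed.

Section Fibres.

Context {A B : Type} (f : A -> B).

Definition fib (b : B) : Type := {x : A & paths (f x) b}.

Definition path_fib {x x' : A} {b : B} (p : paths (f x) b) (q : paths (f x') b)
  (w : {e : paths x x' & paths (concat (ap f e) q) p}) :
  paths (existT (fun z => paths (f z) b) x p) (existT (fun z => paths (f z) b) x' q).
Proof.
  destruct w as [e r]. destruct e, r. exact (ap (existT _ x) (concat_1p q)).
Defined.

Definition fib_path {b : B} (u v : fib b) (e : paths u v) :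
  {e' : paths (projT1 u) (projT1 v) & paths (concat (ap f e') (projT2 v)) (projT2 u)}.
Proof. destruct e. exists idpath. apply concat_1p. Defined.

Lemma fib_path_path_fib {x x' : A} {b : B} (p : paths (f x) b) (q : paths (f x') b)
  (w : {e : paths x x' & paths (concat (ap f e) q) p}) :
  paths (fib_path _ _ (path_fib p q w)) w.
Proof. destruct w as [e r]. destruct e, r, q. reflexivity. Qed.

Lemma contr_paths_fib_sigma {x x' : A} {b : B} (p : paths (f x) b) (q : paths (f x') b) :
  IsContr (fib b) -> IsContr {e : paths x x' & paths (concat (ap f e) q) p}.
Proof.
  intro H.
  apply (contr_retract (fib_path (existT _ x p) (existT _ x' q)) (path_fib p q)
           (fib_path_path_fib p q)).
  apply contr_paths_contr, H.
Qed.

Lemma contr_fib_half_adjoint (g : B -> A) (eta : forall a, paths (g (f a)) a)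
  (eps : forall b, paths (f (g b)) b)
  (tau : forall a, paths (ap f (eta a)) (eps (f a))) :
  forall b, IsContr (fib b).
Proof.
  intro b. exists (existT _ (g b) (eps b)). intros [x p]. destruct p.
  apply (path_fib (eps (f x)) idpath). exists (eta x). exact (tau x).
Qed.

Definition cocone_of_extension {P : B -> Type} (c : forall a, P (f a))
  (theta : forall b, P b) (k : forall a, paths (c a) (theta (f a))) (b : B) :
  forall u : fib b, paths (transport P (projT2 u) (c (projT1 u))) (theta b).
Proof. intros [x p]. destruct p. exact (k x). Defined.

Context (fe : Funext) (Hf : forall b, IsContr (fib b)).

Lemma contr_sections : IsContr {g : B -> A & forall b, paths (f (g b)) b}.
Proof.
  apply (contr_retract
    (fun w : forall b, fib b => existT _ (fun b => projT1 (w b)) (fun b => projT2 (w b)))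
    (fun w b => existT (fun x => paths (f x) b) (projT1 w b) (projT2 w b))).
  - intros [g eps]. reflexivity.
  - apply contr_forall; assumption.
Qed.

(* [concat (ap f e) idpath] computes to [ap f e], so [(eta a, tau a)] is
   literally the data of a [path_fib] from [(g (f a); eps (f a))] to [(a; idpath)]. *)
Lemma contr_coherent_units (g : B -> A) (eps : forall b, paths (f (g b)) b) :
  IsContr {eta : forall a, paths (g (f a)) a &
           forall a, paths (ap f (eta a)) (eps (f a))}.
Proof.
  apply (contr_retract
    (fun w : forall a, {e : paths (g (f a)) a & paths (ap f e) (eps (f a))} =>
       existT _ (fun a => projT1 (w a)) (fun a => projT2 (w a)))
    (fun w a => existT (fun e => paths (ap f e) (eps (f a))) (projT1 w a) (projT2 w a))).
  - intros [eta tau]. reflexivity.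
  - apply contr_forall; [exact fe |]. intro a.
    exact (contr_paths_fib_sigma (eps (f a)) idpath (Hf (f a))).
Qed.

Lemma contr_extension_along (P : B -> Type) (c : forall a, P (f a)) :
  IsContr {theta : forall b, P b & forall a, paths (c a) (theta (f a))}.
Proof.
  apply (contr_retract
    (fun w : forall b, {t : P b & forall u : fib b,
                          paths (transport P (projT2 u) (c (projT1 u))) t} =>
       existT _ (fun b => projT1 (w b)) (fun a => projT2 (w (f a)) (existT _ a idpath)))
    (fun w b => existT _ (projT1 w b) (cocone_of_extension c (projT1 w) (projT2 w) b))).
  - intros [theta k]. reflexivity.
  - apply contr_forall; [exact fe |]. intro b. apply contr_cocone_contr; auto.
Qed.

Lemma contr_ish2adj : IsContr (ish2adj f).
Proof.
  apply contr_sigma_swap, contr_sigma_curried.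
  - exact contr_sections.
  - intros g eps. apply contr_sigma_curried.
    + apply contr_coherent_units.
    + intros eta tau. apply contr_extension_along.
Qed.

End Fibres.

Theorem theorem3p6 (fe : Funext) (A B : Type) (f : A -> B) :
  IsHProp (ish2adj f).
Proof.
  apply hprop_inhabited_contr. intros [g [eta [eps [tau _]]]].
  exact (contr_ish2adj f fe (contr_fib_half_adjoint f g eta eps tau)).
Qed.
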